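(* Let $r,m$ be integers with $0<r\le m$ and $\gcd(r,m)=1$. If $1\le n\le m$, then $$s_{r,m}(n)=\begin{cases}1,&\text{if } r\mid n,\\ 0,&\text{if } r\nmid n.\end{cases}$$ If $n>m$, then $s_{r,m}(n)=s_{r,m}(n-r)+s_{r,m}(n-m)$.
   Context: Natural numbers are positive integers. A composition of a natural number $n$ is an ordered finite sequence $(a_1,\dots,a_k)$, $k\ge 1$, of natural numbers (called its parts) with $n=a_1+a_2+\cdots+a_k$; sequences differing in order are different compositions. For a natural number $n$, $s_{r,m}(n)$ denotes the number of compositions of $n$ all of whose parts are congruent to $r$ modulo $m$. *)

(* Defs.v *)
From mathcomp Require Import all_boot.

Set Implicit Arguments.
Unset Strict Implicit.
Unset Printing Implicit Defensive.

Definition is_composition (n : nat) (a : seq nat) : bool :=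
  [&& a != [::], all (fun x => 0 < x) a & sumn a == n].

(* A composition of n has at most n parts, each at most n (composition_bounds),
   so all of them lie in the finite type n.-bseq 'I_n.+1 of sequences of length
   at most n over {0, ..., n}; num_compositionsE checks that none is lost. *)
Definition num_compositions (r m n : nat) : nat :=
  #|[set a : n.-bseq 'I_n.+1 |
      is_composition n (map val a) && all (fun x => x == r %[mod m]) (map val a)]|.

Lemma composition_bounds n (a : seq nat) :
  is_composition n a -> (size a <= n) && all (fun x => x <= n) a.
Proof.
case/and3P=> _ a_gt0 /eqP <-; elim: a a_gt0 => //= x a IHa /andP[x_gt0 a_gt0].
have /andP[sza lea] := IHa a_gt0.
rewrite -add1n leq_add // leq_addr /=.
by apply: sub_all lea => y /leq_trans; apply; apply: leq_addl.
Qed.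

Lemma num_compositionsE r m n (L : seq (seq nat)) :
  uniq L ->
  (forall a, (a \in L) =
     is_composition n a && all (fun x => x == r %[mod m]) a) ->
  num_compositions r m n = size L.
Proof.
move=> uL memL; rewrite /num_compositions cardE.
rewrite -(size_map (fun a : n.-bseq 'I_n.+1 => map val a)).
apply: perm_size; apply: uniq_perm => //.
  by rewrite map_inj_uniq ?enum_uniq // => a b /(inj_map val_inj)/val_inj.
move=> a; rewrite memL; apply/mapP/idP => [[b]|Pa].
  by rewrite mem_enum inE => Pb ->.
have /andP[/composition_bounds/andP[sza lea] _] := Pa.
have szb : size (map (@inord n) a) <= n by rewrite size_map.
have aE : a = map val (map (@inord n) a).
  rewrite -map_comp -[LHS]map_id; apply/eq_in_map => x /(allP lea) le_xn /=.
  by rewrite inordK.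
by exists (Bseq szb); rewrite ?mem_enum ?inE /= -aE.
Qed.

(* Main.v *)
Require Import Defs.
From mathcomp Require Import all_boot.

Set Implicit Arguments.
Unset Strict Implicit.
Unset Printing Implicit Defensive.

(** The admissible parts are r, r + m, r + 2m, ...  For n <= m only r is small
    enough to occur.  For n > m, a composition either starts with r, which can
    be deleted, or starts with a part greater than m, which can be lowered by
    m; both operations are reversible. *)

Definition part (r m x : nat) : bool := (0 < x) && (x == r %[mod m]).

(** Sending [[::]] to itself makes the map injective on all sequences, so no nonemptiness side
    condition arises. *)
Definition add_head (m : nat) (a : seq nat) : seq nat :=
  if a is x :: s then m + x :: s else [::].

(** With explicit duplicate-free lists, the recurrence between counts becomes a concatenation of
    lists. *)
Definition enumerates (r m n : nat) (L : seq (seq nat)) : Prop :=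
  uniq L /\ forall a, (a \in L) =
    is_composition n a && all (fun x => x == r %[mod m]) a.

Lemma size_enumerates r m n L :
  enumerates r m n L -> num_compositions r m n = size L.
Proof. by case=> uL memL; apply: num_compositionsE. Qed.

Lemma part_compositionE r m n a :
  is_composition n a && all (fun x => x == r %[mod m]) a =
  [&& a != [::], all (part r m) a & sumn a == n].
Proof.
by rewrite /is_composition /part (all_predI (fun x => 0 < x)) -!andbA; do !bool_congr.
Qed.

(** Positivity of [x] matters: if [r = m > 0], then [m] is an admissible part but [0] is not. *)
Lemma part_addm r m x : 0 < x -> part r m (m + x) = part r m x.
Proof. by move=> x_gt0; rewrite /part modnDl addn_gt0 x_gt0 orbT. Qed.

Lemma add_head_inj m : injective (add_head m).
Proof. by case=> [|x s] [|y t] //= [/addnI -> ->]. Qed.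

Section Parts.

Variables (r m : nat).
Hypotheses (r_gt0 : 0 < r) (le_rm : r <= m).

Lemma part_r : part r m r.
Proof. by rewrite /part r_gt0 eqxx. Qed.

(** If [0 < x < r], then [m] would divide [r - x], which lies strictly between [0] and [m]. *)
Lemma part_geq x : part r m x -> r <= x.
Proof.
case/andP=> x_gt0 xr; rewrite leqNgt; apply/negP => lt_xr.
move: xr; rewrite eq_sym eqn_mod_dvd ?(ltnW lt_xr) // => /dvdn_leq.
rewrite subn_gt0 lt_xr leqNgt => /(_ isT)/negP; apply.
by apply: leq_trans le_rm; rewrite ltn_subrL x_gt0.
Qed.

Lemma part_r_or_gtm x : part r m x -> x = r \/ exists2 y, part r m y & x = m + y.
Proof.
move=> px; have le_rx := part_geq px.
case: (ltngtP r x) le_rx => // [lt_rx _|-> _]; last by left.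
have le_mxr : m <= x - r.
  case/andP: px => _; rewrite eqn_mod_dvd ?(ltnW lt_rx) // => /dvdn_leq.
  by rewrite subn_gt0; apply.
(* The inequality is strict because [r > 0]; hence [x - m] is positive and again a part. *)
have lt_mx : m < x.
  by apply: leq_ltn_trans le_mxr _; rewrite ltn_subrL r_gt0 (ltn_trans r_gt0).
have xE : x = m + (x - m) by rewrite subnKC // ltnW.
right; exists (x - m) => //.
by rewrite -part_addm ?subn_gt0 // -xE.
Qed.

Lemma enumerates_leqm n : 0 < n <= m ->
  enumerates r m n (if r %| n then [:: nseq (n %/ r) r] else [::]).
Proof.
case/andP=> n_gt0 le_nm; split=> [|a]; first by case: ifP.
rewrite part_compositionE.
apply/idP/and3P => [|[a_n0 pa /eqP sum_a]].
  case: ifP => // r_n; rewrite inE => /eqP ->.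
  rewrite all_nseq part_r orbT sumn_nseq mulnC divnK // eqxx.
  by rewrite -size_eq0 size_nseq -lt0n divn_gt0 // dvdn_leq.
(* An entry is at most the sum [n <= m], which excludes the form [m + y] with [y > 0]. *)
have aE : a = nseq (size a) r.
  apply/all_pred1P/allP => x x_a /=.
  have [-> //|[y py xE]] := part_r_or_gtm (allP pa x x_a).
  have le_xn : x <= n.
    by rewrite -sum_a sumnE (perm_big _ (perm_to_rem x_a)) big_cons leq_addr.
  have := leq_trans le_xn le_nm.
  by case/andP: py => y_gt0 _; rewrite xE leqNgt -[X in X < _]addn0 ltn_add2l y_gt0.
have nE : n = size a * r by rewrite -sum_a {1}aE sumn_nseq mulnC.
by rewrite nE dvdn_mull // mulnK // inE -aE.
Qed.

Lemma enumerates_gtm n L1 L2 : m < n ->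
  enumerates r m (n - r) L1 -> enumerates r m (n - m) L2 ->
  enumerates r m n (map (cons r) L1 ++ map (add_head m) L2).
Proof.
move=> lt_mn [uL1 memL1] [uL2 memL2].
have lt_rn : r < n := leq_ltn_trans le_rm lt_mn.
split=> [|a].
  rewrite cat_uniq !map_inj_uniq ?uL1 ?uL2 ?andbT //=.
  (* The two images are disjoint: heads in the second are [m + x] with [x > 0], hence exceed
     [m >= r]. *)
  - apply/hasPn => _ /mapP[b + ->]; rewrite memL2 part_compositionE.
    case: b => [//|x s] /and3P[_ /= /andP[/andP[x_gt0 _] _] _].
    apply/mapP => -[c _ [mx _]]; move: le_rm.
    by rewrite -mx -[X in _ <= X]addn0 leq_add2l leqNgt x_gt0.
  - exact: add_head_inj.
  - by move=> b c [].
rewrite mem_cat part_compositionE; apply/orP/and3P => [[]|[]].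
- case/mapP=> b + ->; rewrite memL1 part_compositionE => /and3P[_ pb /eqP sum_b].
  by rewrite /= part_r pb sum_b subnKC // ltnW.
- case/mapP=> b + ->; rewrite memL2 part_compositionE.
  case: b => [//|x s] /and3P[_ /= /andP[px ps] /eqP sum_b].
  have /andP[x_gt0 _] := px.
  by rewrite part_addm // px ps -addnA sum_b subnKC // ltnW.
case: a => [//|x s] _ /= /andP[px ps] /eqP sum_a.
have [xE|[y py xE]] := part_r_or_gtm px; [left|right].
  have sum_s : sumn s = n - r by rewrite -sum_a xE addKn.
  rewrite xE map_f // memL1 part_compositionE ps sum_s eqxx !andbT.
  (* The tail is nonempty, since its sum [n - r] is positive. *)
  by apply/eqP => s0; move: lt_rn; rewrite -subn_gt0 -sum_s s0.
apply/mapP; exists (y :: s); last by rewrite xE.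
by rewrite memL2 part_compositionE /= py ps -sum_a xE -addnA addKn eqxx.
Qed.

(** Supplies the lists for [n - r] and [n - m] that the recurrence takes as input. Strong induction
    applies because both numbers are positive and smaller than [n] when [n > m]. *)
Lemma enumerates_ex n : 0 < n -> exists L, enumerates r m n L.
Proof.
elim/ltn_ind: n => n IHn n_gt0.
case: (leqP n m) => [le_nm|lt_mn].
  by eexists; apply: enumerates_leqm; rewrite n_gt0.
have m_gt0 := leq_trans r_gt0 le_rm.
have [||L1 L1P] := IHn (n - r).
- by rewrite ltn_subrL r_gt0.
- by rewrite subn_gt0 (leq_ltn_trans le_rm).
have [||L2 L2P] := IHn (n - m).
- by rewrite ltn_subrL m_gt0.
- by rewrite subn_gt0.
by eexists; apply: enumerates_gtm L1P L2P.
Qed.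

End Parts.

Theorem theorem2 (r m : nat) (r_gt0 : 0 < r) (le_rm : r <= m)
    (gcd_rm : gcdn r m = 1) :
  (forall n : nat, 1 <= n <= m ->
     num_compositions r m n = if r %| n then 1 else 0) /\
  (forall n : nat, m < n ->
     num_compositions r m n =
       num_compositions r m (n - r) + num_compositions r m (n - m)).
Proof.
split=> n => [n_bounds|lt_mn].
  rewrite (size_enumerates (enumerates_leqm r_gt0 le_rm n_bounds)).
  by case: ifP.
have [|L1 L1P] := @enumerates_ex r m r_gt0 le_rm (n - r).
  by rewrite subn_gt0 (leq_ltn_trans le_rm).
have [|L2 L2P] := @enumerates_ex r m r_gt0 le_rm (n - m); first by rewrite subn_gt0.
have LP := enumerates_gtm r_gt0 le_rm lt_mn L1P L2P.
rewrite (size_enumerates LP) (size_enumerates L1P).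
by rewrite (size_enumerates L2P) size_cat !size_map.
Qed.
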